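(* The simple involutions that avoid $2341$ are exactly the permutation $5274163$ together with the simple involutions that avoid $123$.
   Context: A permutation $\pi$ contains $\sigma$ if $\pi$ has a subsequence order isomorphic to $\sigma$; otherwise it avoids $\sigma$. An involution is a permutation equal to its own inverse. An interval of a permutation $\pi$ of length $n$ is a set of contiguous positions whose set of values is also contiguous; intervals of size $0$, $1$ and $n$ are trivial. A permutation of length at least $2$ is simple if it has no nontrivial intervals. Permutations are written in one-line notation. *)

(* Defs.v *)
From mathcomp Require Import all_boot all_fingroup.

Set Implicit Arguments.
Unset Strict Implicit.
Unset Printing Implicit Defensive.

(* The positions and values of a permutation in 'S_n are numbered from 0;
   one-line notation shifts the values so that they are numbered from 1. *)
Definition one_line (n : nat) (pi : 'S_n) : seq nat :=
  [seq (nat_of_ord (pi i)).+1 | i : 'I_n].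

Definition order_isomorphic (s t : seq nat) : Prop :=
  size s = size t /\
  forall i j : nat, i < size s -> j < size s ->
    (nth 0 s i < nth 0 s j) = (nth 0 t i < nth 0 t j).

(* The pattern sigma is given in one-line notation. *)
Definition contains (n : nat) (pi : 'S_n) (sigma : seq nat) : Prop :=
  exists2 t : seq nat, subseq t (one_line pi) & order_isomorphic t sigma.

Definition avoids (n : nat) (pi : 'S_n) (sigma : seq nat) : Prop :=
  ~ contains pi sigma.

Definition involution (n : nat) (pi : 'S_n) : Prop := (pi^-1)%g = pi.

Definition contiguous (n : nat) (A : {set 'I_n}) : Prop :=
  exists a b : nat, A = [set i : 'I_n | a <= i < b].

Definition perm_interval (n : nat) (pi : 'S_n) (A : {set 'I_n}) : Prop :=
  contiguous A /\ contiguous (pi @: A).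

Definition simple_perm (n : nat) (pi : 'S_n) : Prop :=
  2 <= n /\
  forall A : {set 'I_n}, perm_interval pi A ->
    [\/ #|A| = 0, #|A| = 1 | #|A| = n].

(* Main.v *)
Require Import Defs.
From mathcomp Require Import all_boot all_fingroup.
From mathcomp Require Import zify.

Set Implicit Arguments.
Unset Strict Implicit.
Unset Printing Implicit Defensive.

(** Let x be the leftmost position that starts a 123 in pi, and z the rightmost
position that ends a 123 starting at x.  Avoidance of 2341 and of its inverse
4123 says that nothing lies below and to the right of a 123, or above and to its
left.  Together with the extremality of x and z and the absence of proper
intervals this forces pi(x) = x and then pi(z) = z: otherwise [x, max pi([x, pi(x)[)],
respectively [pi(z), z], is mapped to itself.  By simplicity some i < x has
pi(i) > x and some r > z has pi(r) < z, so the middle square ]x, z[ x ]x, z[ is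
squeezed between the positions sent above z and those sent below x.  It is
therefore an interval, i.e. a single fixed point b, and pi exchanges ]x, b[ with
]z, n[ and ]b, z[ with [0, x[.  These are intervals too, hence singletons, which
leaves only 5274163. *)

(** * Simple 2341-avoiding involutions as functions on natural numbers *)

Record simple_involution_av2341 (n : nat) (f : nat -> nat) : Prop := {
  inv_lt : forall i, i < n -> f i < n;
  invK : forall i, i < n -> f (f i) = i;
  inv_simple : forall a b c, 1 < b - a < n -> b <= n ->
    ~ (forall i, a <= i < b -> c <= f i < c + (b - a));
  inv_av2341 : forall i j k l, i < j < k -> k < l < n ->
    ~~ [&& f l < f i, f i < f j & f j < f k] }.

Definition increasing3 (n : nat) (f : nat -> nat) (i j k : nat) : bool :=
  [&& i < j, j < k, k < n, f i < f j & f j < f k].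

Definition leftmost_start (n : nat) (f : nat -> nat) (x : nat) : Prop :=
  forall i j k, increasing3 n f i j k -> x <= i.

Definition rightmost_end (n : nat) (f : nat -> nat) (x z : nat) : Prop :=
  forall j k, increasing3 n f x j k -> k <= z.

(** * Extremal choices *)

Lemma exists_extremal_increasing3 n f i j k : increasing3 n f i j k ->
  exists x b z, [/\ increasing3 n f x b z, leftmost_start n f x
                  & rightmost_end n f x z].
Proof.
move=> inc_ijk.
pose P u := [exists v : 'I_n, exists w : 'I_n, increasing3 n f u v w].
have P_intro u v w : increasing3 n f u v w -> P u.
  move=> inc; have [v_n w_n] : v < n /\ w < n by case/and5P: inc; lia.
  by apply/existsP; exists (Ordinal v_n); apply/existsP; exists (Ordinal w_n).
have exP : exists u, P u by exists i; apply: P_intro inc_ijk.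
case: (ex_minnP exP) => x /existsP[b0 /existsP[z0 inc0]] min_x.
pose Q w := [exists v : 'I_n, increasing3 n f x v w].
have Q_intro v w : increasing3 n f x v w -> Q w.
  move=> inc; have v_n : v < n by case/and5P: inc; lia.
  by apply/existsP; exists (Ordinal v_n).
have exQ : exists w, Q w by exists z0; apply: Q_intro inc0.
have leQ w : Q w -> w <= n by case/existsP=> v /and5P[]; lia.
case: (ex_maxnP exQ leQ) => z /existsP[b inc] max_z.
by exists x, b, z; split=> // [u v w /P_intro /min_x|v w /Q_intro /max_z].
Qed.

Lemma exists_argmax_nat (f : nat -> nat) (P : pred nat) a b i :
    a <= i < b -> P i ->
  exists2 p, (a <= p < b) && P p & forall i, a <= i < b -> P i -> f i <= f p.
Proof.
move=> ab Pi; have i_b : i < b by lia.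
pose P' := [pred o : 'I_b | (a <= o) && P o].
have P'i : P' (Ordinal i_b) by rewrite /= Pi andbT; lia.
case: (@arg_maxnP _ (Ordinal i_b) P' f P'i) => p /= /andP[ap Pp] max_p.
exists p => [|u ub Pu]; first by rewrite ap ltn_ord Pp.
have u_b : u < b by lia.
by apply: (max_p (Ordinal u_b)); rewrite /= Pu andbT; lia.
Qed.

(** * Injectivity, counting and forbidden patterns *)

Lemma inv_neq n f i j : simple_involution_av2341 n f ->
  i < n -> j < n -> i <> j -> f i <> f j.
Proof.
by move=> Hf i_n j_n ij fij; apply: ij; rewrite -(invK Hf i_n) fij (invK Hf j_n).
Qed.

(** Pigeonhole for the injective [f]; used in both directions, it shows that two blocks exchanged by
    [f] have equal length. *)
Lemma interval_size_le n f a b c d : simple_involution_av2341 n f -> b <= n ->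
  (forall i, a <= i < b -> c <= f i < d) -> b - a <= d - c.
Proof.
move=> Hf b_n fab; rewrite -(size_iota a (b - a)) -(size_iota c (d - c)) -(size_map f).
apply: uniq_leq_size => [|_ /mapP[i i_ab ->]].
  rewrite map_inj_in_uniq ?iota_uniq // => i j; rewrite !mem_iota => i_ab j_ab fij.
  by apply/eqP/negPn/negP => /eqP /(inv_neq Hf); apply=> //; lia.
by move: i_ab; rewrite !mem_iota => i_ab; have := fab i; lia.
Qed.

(** The diagram of an involution is symmetric about the diagonal, and 123 is its own inverse. *)
Lemma increasing3_inv n f i j k : simple_involution_av2341 n f ->
  increasing3 n f i j k -> increasing3 n f (f i) (f j) (f k).
Proof.
move=> Hf /and5P[ij jk kn fij fjk]; have fkn := inv_lt Hf kn.
by rewrite /increasing3 !(invK Hf) ?fij ?fjk ?fkn ?ij ?jk //; lia.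
Qed.

(* 4123 is the inverse of 2341. *)
Lemma inv_av4123 n f i j k l : simple_involution_av2341 n f ->
  i < j -> increasing3 n f j k l -> f i < f l.
Proof.
move=> Hf ij /and5P[jk kl ln fjk fkl].
have := inv_neq Hf (i := i) (j := l).
have := inv_av2341 Hf (i := f j) (j := f k) (k := f l) (l := f i).
rewrite !(invK Hf); try lia.
have := inv_lt Hf (i := i); lia.
Qed.

Lemma increasing3_av2341 n f i j k l : simple_involution_av2341 n f ->
  increasing3 n f i j k -> k < l < n -> f i < f l.
Proof.
move=> Hf /and5P[ij jk kn fij fjk] kl.
have := inv_neq Hf (i := i) (j := l).
have := inv_av2341 Hf (i := i) (j := j) (k := k) (l := l).
lia.
Qed.

(** * Fixed points at the two ends of the extremal 123 *)

Lemma leftmost_start_fixed n f x b z : simple_involution_av2341 n f ->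
  increasing3 n f x b z -> leftmost_start n f x -> f x = x.
Proof.
move=> Hf inc min_x; have inc' := increasing3_inv Hf inc.
have x_fx := min_x _ _ _ inc'.
case/and5P: (inc) => xb bz zn fxb fbz; case/and5P: (inc') => _ _ fzn ffxb ffbz.
have fK := invK Hf.
case: (ltngtP x (f x)) x_fx => // xfx _; exfalso.
have [|p /andP[p_xy _] max_p] := @exists_argmax_nat f predT x (f x) x _ isT; first lia.
have fpx : f x <= f p by apply: max_p => //; lia.
have fpz : f p < z.
  by have := inv_av4123 Hf (i := p) _ inc'; rewrite fK //; apply; lia.
have fffx : f (f x) = x by apply: fK; lia.
have ffp : f (f p) = p by apply: fK; lia.
have ffz : f (f z) = z by apply: fK; lia.
apply: (inv_simple Hf (a := x) (b := (f p).+1) (c := x)); try lia.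
move=> q q_int.
have qn : q < n by lia.
have fqn := inv_lt Hf qn; have ffq := fK _ qn.
(* If [f q < x], a 123 starts at [f q]: it continues with [b], [z] when [q < f x], and with [p],
   [f z] otherwise. *)
have x_fq : x <= f q.
  rewrite leqNgt; apply/negP => fq_x.
  have [q_fx|fx_q] := ltnP q (f x).
    have /min_x : increasing3 n f (f q) b z by rewrite /increasing3 ffq; lia.
    lia.
  have q_fp : q != f p by apply/eqP => q_fp; move: fq_x; rewrite q_fp ffp; lia.
  have /min_x : increasing3 n f (f q) p (f z) by rewrite /increasing3 ffq ffz; lia.
  lia.
(* By the choice of [p], a larger [f q] forces [f x <= q]; then the positions [x < p < q < f p]
   carry a 2341. *)
suff : f q <= f p by lia.
have [q_fx|fx_q] := ltnP q (f x); first by apply: max_p => //; lia.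
rewrite leqNgt; apply/negP => fp_fq.
have q_fp : q != f p by apply/eqP => q_fp; move: fp_fq; rewrite q_fp ffp; lia.
have q_fx : q != f x by apply/eqP => q_fx; move: fp_fq; rewrite q_fx fffx; lia.
have p_x : p != x by apply/eqP => p_x; move: q_int; rewrite p_x; lia.
have := inv_av2341 Hf (i := x) (j := p) (k := q) (l := f p); rewrite ffp.
have fx_fp : f x <> f p by apply: (inv_neq Hf); lia.
lia.
Qed.

(** Otherwise [[0, x[] is stable, so [[0, x]] is a nontrivial interval; when [x = 0] that is a
    singleton, and [[1, n[] is used instead. *)
Lemma exists_above_fixed_point n f x : simple_involution_av2341 n f ->
  2 < n -> x.+1 < n -> f x = x -> exists2 i, i < x & x < f i.
Proof.
move=> Hf n3 xn fx.
have [/hasP[i]|/hasPn no] := boolP (has (fun i => x < f i) (iota 0 x)).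
  by rewrite mem_iota; exists i.
have below i : i < x -> f i < x.
  move=> ix; have := no i; have := inv_neq Hf (i := i) (j := x).
  by rewrite mem_iota; lia.
exfalso; have [x0|x0] := posnP x.
  apply: (inv_simple Hf (a := 1) (b := n) (c := 1)) => [||i i_n]; try lia.
  have := inv_neq Hf (i := i) (j := x); have := inv_lt Hf (i := i); lia.
apply: (inv_simple Hf (a := 0) (b := x.+1) (c := 0)) => [||i i_x]; try lia.
by have [->|ix] := eqVneq i x; last have := below i; lia.
Qed.

Lemma exists_below_fixed_point n f z : simple_involution_av2341 n f ->
  2 < n -> 0 < z < n -> f z = z -> exists2 i, z < i < n & f i < z.
Proof.
move=> Hf n3 zn fz.
have [/hasP[i]|/hasPn no] := boolP (has (fun i => f i < z) (iota z.+1 (n - z.+1))).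
  by rewrite mem_iota => zi fi; exists i => //; lia.
have above i : z < i < n -> z < f i.
  move=> zi; have := no i; have := inv_neq Hf (i := i) (j := z).
  by rewrite mem_iota; lia.
exfalso; have [z_n|z_n] := eqVneq z.+1 n.
  apply: (inv_simple Hf (a := 0) (b := z) (c := 0)) => [||i i_z]; try lia.
  have := inv_neq Hf (i := i) (j := z); have := inv_lt Hf (i := i); lia.
apply: (inv_simple Hf (a := z) (b := n) (c := z)) => [||i i_z]; try lia.
have [->|iz] := eqVneq i z; first lia.
by have := above i; have := inv_lt Hf (i := i); lia.
Qed.

Lemma rightmost_end_fixed n f x b z : simple_involution_av2341 n f ->
  increasing3 n f x b z -> leftmost_start n f x -> rightmost_end n f x z ->
  f z = z.
Proof.
move=> Hf inc min_x max_z; have fx := leftmost_start_fixed Hf inc min_x.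
have inc' := increasing3_inv Hf inc; rewrite fx in inc'.
have fz_z := max_z _ _ inc'.
case/and5P: (inc) => xb bz zn fxb fbz; case/and5P: (inc') => x_fb fb_fz fzn _ _.
have fK := invK Hf.
case: (ltngtP (f z) z) fz_z => // wz _; exfalso.
have ffz : f (f z) = z by apply: fK; lia.
have [|||i ix xfi] := exists_above_fixed_point Hf (x := x); try lia.
have ffi : f (f i) = i by apply: fK; lia.
have fi_fz := inv_av4123 Hf ix inc.
apply: (inv_simple Hf (a := f z) (b := z.+1) (c := f z)); try lia.
move=> s s_int.
have sn : s < n by lia.
have fsn := inv_lt Hf sn; have ffs := fK _ sn.
have [->|s_fz] := eqVneq s (f z); first lia.
have [->|s_z] := eqVneq s z; first lia.
(* If [f s > z], the 123 at [x, b, f s] ends too late. If [f s < x], then [f s, x, b, z] carry a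
   4123. If [x <= f s < f z], the 123 at [i, f s, f z] starts too early. *)
have above := max_z b (f s).
have left_av := inv_av4123 Hf (i := f s) _ inc.
have start := min_x i (f s) (f z).
rewrite /increasing3 in above start.
have [fsi|fsi] := eqVneq (f s) i; first by have := congr1 f fsi; lia.
lia.
Qed.

(** * The middle square and the form of 5274163 *)

Lemma leftmost_rightmost_eq5274163 n f x b z : simple_involution_av2341 n f ->
  increasing3 n f x b z -> leftmost_start n f x -> rightmost_end n f x z ->
  map f (iota 0 n) = [:: 4; 1; 6; 3; 0; 5; 2].
Proof.
move=> Hf inc min_x max_z; have fx := leftmost_start_fixed Hf inc min_x.
have fz := rightmost_end_fixed Hf inc min_x max_z.
case/and5P: (inc) => xb bz zn fxb fbz.
have fK := invK Hf.
have [|||i ix xfi] := exists_above_fixed_point Hf (x := x); try lia.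
have [|||r zr frz] := exists_below_fixed_point Hf (z := z); try lia.
have fi_z := inv_av4123 Hf ix inc.
have fr_x := increasing3_av2341 Hf inc zr.
have ffi : f (f i) = i by apply: fK; lia.
have ffr : f (f r) = r by apply: fK; lia.
(* [f r] and [f i] lie strictly between [x] and [z] and are sent above [z] and below [x], so the
   last position of the first kind and the first of the second kind exist. *)
have [|/= |e0 /andP[e0_xz fe0] max_e] :=
  @exists_argmax_nat id (fun e => z < f e) x.+1 z (f r); try lia.
(* Maximising [z - j] picks the smallest [j]. *)
have [|/= |j0 /andP[j0_xz fj0] min_j] :=
  @exists_argmax_nat (subn z) (fun j => f j < x) x.+1 z (f i); try lia.
(* If [f u > j0], the 123 at [f j0, u, z] starts before [x]; if [f u < e0], the 123 at [x, u, f e0]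
   ends after [z]. Applying this to [u = f m] bounds [m]. *)
have mid m : x < m < z -> x < f m < z -> e0 < m < j0.
  suff half u : x < u < z -> x < f u < z -> e0 < f u < j0.
    by move=> m_xz fm_xz; rewrite -(fK m); [apply: half => //; rewrite fK; lia | lia].
  move=> u_xz fu_xz.
  have ffu : f (f u) = u by apply: fK; lia.
  have ffe0 : f (f e0) = e0 by apply: fK; lia.
  have ffj0 : f (f j0) = j0 by apply: fK; lia.
  have := min_x (f j0) u z; have := max_z u (f e0).
  have := inv_lt Hf (i := e0).
  have [uj|uj] := eqVneq (f u) j0; first by have := congr1 f uj; lia.
  have [ue|ue] := eqVneq (f u) e0; first by have := congr1 f ue; lia.
  rewrite /increasing3; lia.
have neq u : x < u < z -> (f u != x) && (f u != z).
  have := inv_neq Hf (i := u) (j := x); have := inv_neq Hf (i := u) (j := z); lia.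
have core s : e0 < s < j0 -> x < f s < z.
  move=> s_ej; have := max_e s; have := min_j s; have := neq s; lia.
have e0b : e0 < b < j0 by apply: mid; lia.
have mid' s : e0 < s < j0 -> e0 < f s < j0.
  move=> s_ej; have := core s s_ej => fs.
  apply: mid => //; rewrite fK; lia.
(* The positions strictly between [e0] and [j0] are stable under [f] and include [b]; by simplicity
   [b] is the only one. *)
have size_ej : j0 = e0.+2.
  have [//|ne] := eqVneq j0 e0.+2; exfalso.
  apply: (inv_simple Hf (a := e0.+1) (b := j0) (c := e0.+1)); try lia.
  move=> s s_ej; have := mid' s; lia.
have fb : f b = b by have := mid' b; lia.
have left_pts s : x < s < b -> z < f s.
  move=> s_xb; have := neq s; have := mid s; have := min_j s; lia.
have right_pts s : b < s < z -> f s < x.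
  move=> s_bz; have := neq s; have := mid s; have := max_e s; lia.
have last_pts s : z < s < n -> x < f s < b.
  move=> s_zn; have := increasing3_av2341 Hf inc s_zn.
  have := inv_neq Hf (i := s) (j := z).
  have := max_z z s; have := max_e (f s); rewrite fK /increasing3; lia.
have first_pts s : s < x -> b < f s < z.
  move=> s_x; have := inv_av4123 Hf s_x inc.
  have := inv_neq Hf (i := s) (j := x).
  have := min_x s x z; have := min_j (f s); rewrite fK /increasing3; lia.
have lt_n s := inv_lt Hf (i := s).
have left_last s : x.+1 <= s < b -> z.+1 <= f s < n.
  by have := left_pts s; have := lt_n s; lia.
have right_first s : b.+1 <= s < z -> 0 <= f s < x by have := right_pts s; lia.
(* Each block maps into its partner, so the lengths agree and the image fills the partner;
   simplicity then leaves one point in each block, with [r] and [i] showing that none is empty. *)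
have le1 : b - x.+1 <= n - z.+1 by apply: (interval_size_le Hf _ left_last); lia.
have le2 : n - z.+1 <= b - x.+1 by apply: (interval_size_le Hf _ last_pts); lia.
have le3 : z - b.+1 <= x - 0 by apply: (interval_size_le Hf _ right_first); lia.
have le4 : x - 0 <= z - b.+1.
  by apply: (interval_size_le Hf) => [|s]; [lia | exact: first_pts].
have simple1 := inv_simple Hf (a := x.+1) (b := b) (c := z.+1).
have simple2 := inv_simple Hf (a := b.+1) (b := z) (c := 0).
have b_x : b = x.+2.
  have [//|ne] := eqVneq b x.+2; exfalso; apply: simple1; try lia.
  by move=> s; have := left_last s; lia.
have z_b : z = b.+2.
  have [//|ne] := eqVneq z b.+2; exfalso; apply: simple2; try lia.
  by move=> s; have := right_first s; lia.
have x1 : x = 1 by lia.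
have n7 : n = 7 by lia.
(* The bounds leave one value at each of 0, 2, 4, 6; the positions 1, 3, 5 are the fixed points [x],
   [b], [z]. *)
have := first_pts 0; have := left_pts 2; have := right_pts 4; have := last_pts 6.
have := lt_n 2; subst x b z n => /=.
by move=> *; do ![congr (_ :: _); first lia].
Qed.

(** * From permutations and patterns to functions on natural numbers *)

(* Extended by the identity outside ['I_n]. *)
Definition perm_fun (n : nat) (pi : 'S_n) (i : nat) : nat :=
  oapp (fun o : 'I_n => nat_of_ord (pi o)) i (insub i).

Lemma perm_fun_ord n (pi : 'S_n) (o : 'I_n) : perm_fun pi o = pi o.
Proof. by rewrite /perm_fun valK. Qed.

Lemma one_lineE n (pi : 'S_n) :
  one_line pi = [seq (perm_fun pi i).+1 | i <- iota 0 n].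
Proof.
rewrite /one_line /image_mem -val_enum_ord -map_comp.
by apply: eq_map => o /=; rewrite perm_fun_ord.
Qed.

Lemma subseq_iota s n : subseq s (iota 0 n) = sorted ltn s && all (gtn n) s.
Proof.
apply/idP/andP => [sub_s|[sorted_s /allP lt_s]].
  split; first exact: subseq_sorted ltn_trans _ _ sub_s (iota_ltn_sorted 0 n).
  by apply/allP => i /(mem_subseq sub_s); rewrite mem_iota.
suff -> : s = filter [in s] (iota 0 n) by apply: filter_subseq.
apply: (irr_sorted_eq ltn_trans ltnn) => // [|i].
  by apply: sorted_filter (iota_ltn_sorted 0 n); apply: ltn_trans.
rewrite mem_filter mem_iota /=; case: (boolP (i \in s)) => // /lt_s.
by rewrite /= => ->.
Qed.

(** A subsequence of the word comes from an increasing list of positions, and the shift by one in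
    [one_line] preserves order. *)
Lemma containsP n (pi : 'S_n) sigma : contains pi sigma <->
  exists2 s, sorted ltn s && all (gtn n) s
           & order_isomorphic (map (perm_fun pi) s) sigma.
Proof.
have iso_succ s : order_isomorphic [seq (perm_fun pi i).+1 | i <- s] sigma <->
    order_isomorphic (map (perm_fun pi) s) sigma.
  split=> -[size_s iso_s]; split; move: size_s iso_s; rewrite !size_map // => size_s.
    move=> iso_s i j i_s j_s; rewrite -iso_s ?size_map //.
    by rewrite !(nth_map 0) ?size_map.
  move=> iso_s i j i_s j_s; rewrite -iso_s ?size_map //.
  by rewrite !(nth_map 0) ?size_map.
split=> [[t]|[s]]; last first.
  rewrite -subseq_iota => sub_s /iso_succ iso_s.
  by eexists; [rewrite one_lineE; apply: map_subseq sub_s | exact: iso_s].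
rewrite one_lineE => /subseqP[m size_m ->]; rewrite -map_mask => /iso_succ iso_s.
by eexists; [rewrite -subseq_iota; apply: mask_subseq | exact: iso_s].
Qed.

Lemma contains123P n (pi : 'S_n) : contains pi [:: 1; 2; 3] <->
  exists i j k, increasing3 n (perm_fun pi) i j k.
Proof.
split=> [/containsP[s lt_s [size_s iso_s]]|[i [j [k]]]].
  case: s lt_s size_s iso_s => [|i [|j [|k [|]]]] //= lt_s _ iso_s.
  exists i, j, k; have := iso_s 0 1 isT isT; have := iso_s 1 2 isT isT.
  by rewrite /= /increasing3; lia.
rewrite /increasing3 => inc; apply/containsP.
exists [:: i; j; k]; first by rewrite /=; lia.
by split=> // -[|[|[|a]]] [|[|[|b]]] //=; lia.
Qed.

Lemma contains2341P n (pi : 'S_n) (f := perm_fun pi) :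
  contains pi [:: 2; 3; 4; 1] <->
  exists i j k l, [&& i < j < k, k < l < n & [&& f l < f i, f i < f j & f j < f k]].
Proof.
split=> [/containsP[s lt_s [size_s iso_s]]|[i [j [k [l]]]]].
  case: s lt_s size_s iso_s => [|i [|j [|k [|l [|]]]]] //= lt_s _ iso_s.
  exists i, j, k, l; rewrite /f; have := iso_s 0 1 isT isT; have := iso_s 1 2 isT isT.
  by have := iso_s 3 0 isT isT; rewrite /=; lia.
rewrite /f => inc; apply/containsP.
exists [:: i; j; k; l]; first by rewrite /=; lia.
by split=> // -[|[|[|[|a]]]] [|[|[|[|b]]]] //=; lia.
Qed.

(** The first three entries of a 2341 form a 123. *)
Lemma avoids123_2341 n (pi : 'S_n) :
  avoids pi [:: 1; 2; 3] -> avoids pi [:: 2; 3; 4; 1].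
Proof.
move=> no /contains2341P[i [j [k [l inc]]]]; apply/no/contains123P.
by exists i, j, k; rewrite /increasing3; lia.
Qed.

Lemma card_ord_interval_ge n a b : b <= n -> b - a <= #|[set i : 'I_n | a <= i < b]|.
Proof.
move=> b_n; rewrite -(size_iota a (b - a)) cardE -(size_map val).
apply: uniq_leq_size (iota_uniq _ _) _ => i; rewrite mem_iota => i_ab.
have i_n : i < n by lia.
by apply/mapP; exists (Ordinal i_n) => //; rewrite mem_enum inE /=; lia.
Qed.

Lemma card_ord_interval_le n a b : #|[set i : 'I_n | a <= i < b]| <= b - a.
Proof.
rewrite -(size_iota a (b - a)) cardE -(size_map val).
apply: uniq_leq_size => [|_ /mapP[i + ->]].
  by rewrite (map_inj_uniq val_inj) enum_uniq.
by rewrite mem_enum inE mem_iota /=; lia.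
Qed.

Lemma simple_involution_perm_fun n (pi : 'S_n) : simple_perm pi ->
  involution pi -> avoids pi [:: 2; 3; 4; 1] ->
  simple_involution_av2341 n (perm_fun pi).
Proof.
move=> [_ pi_simple] pi_inv pi_av; split.
- by move=> i i_n; rewrite -[i]/(val (Ordinal i_n)) perm_fun_ord.
- move=> i i_n; rewrite -[i]/(val (Ordinal i_n)) !perm_fun_ord.
  by rewrite -{1}pi_inv permK.
- move=> a b c ab b_n f_ab; pose A := [set i : 'I_n | a <= i < b].
  have cardA : #|A| = b - a.
    by apply/eqP; rewrite eqn_leq card_ord_interval_le card_ord_interval_ge.
  suff piA : perm_interval pi A by case: (pi_simple A piA); rewrite cardA; lia.
  split; first by exists a, b.
  (* The image lies in a window of its own size, hence fills it. *)
  exists c, (c + (b - a)); apply/eqP; rewrite eqEcard card_imset; last exact: perm_inj.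
  have := card_ord_interval_le n c (c + (b - a)); rewrite cardA addKn => ->.
  rewrite andbT.
  apply/subsetP => _ /imsetP[i + ->]; rewrite !inE -perm_fun_ord; exact: f_ab.
- move=> i j k l ijk kl; apply/negP => f_ijkl; apply/pi_av/contains2341P.
  by exists i, j, k, l; rewrite ijk kl.
Qed.

(** * The permutation 5274163, by finite checks *)

(* Indicator sequences of contiguous sets of positions satisfy this, which turns
   the simplicity of 5274163 into a check of the 2^7 masks. *)
Definition convex_mask (s : seq bool) : bool :=
  let I := iota 0 (size s) in
  all (fun u => all (fun v => all (fun w =>
    [==> u < v, v < w, nth false s u, nth false s w => nth false s v]) I) I) I.

Lemma contiguous_convex_mask n (A : {set 'I_n}) : contiguous A ->
  convex_mask [seq o \in A | o <- enum 'I_n].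
Proof.
move=> [a [b ->]]; rewrite /convex_mask size_map size_enum_ord.
apply/allP => u u_n; apply/allP => v v_n; apply/allP => w w_n.
move: u_n v_n w_n; rewrite !mem_iota /= => u_n v_n w_n.
have mem i (i_n : i < n) :
    nth false [seq o \in [set i : 'I_n | a <= i < b] | o <- enum 'I_n] i = (a <= i < b).
  by rewrite (nth_map (Ordinal i_n)) ?size_enum_ord // inE nth_enum_ord.
rewrite !mem //; apply/implyP=> uv; apply/implyP=> vw.
by apply/implyP=> ab_u; apply/implyP; lia.
Qed.

Lemma card_count_enum n (A : {set 'I_n}) :
  #|A| = count id [seq o \in A | o <- enum 'I_n].
Proof. by rewrite cardE size_filter count_map enumT; apply: eq_count. Qed.

Lemma perm5274163_simple_involution n (pi : 'S_n) :
  one_line pi = [:: 5; 2; 7; 4; 1; 6; 3] -> simple_perm pi /\ involution pi.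
Proof.
move=> pi_line; have n7 : n = 7.
  by have := congr1 size pi_line; rewrite one_lineE size_map size_iota.
subst n; have pi_inv : involution pi.
  suff fK : all (fun i => perm_fun pi (perm_fun pi i) == i) (iota 0 7).
    apply/permP => o; apply: (@perm_inj _ pi); rewrite permKV; apply/val_inj => /=.
    have := allP fK o; rewrite mem_iota ltn_ord !perm_fun_ord => /(_ isT)/eqP.
    by move->.
  move: pi_line; rewrite one_lineE => -[f0 f1 f2 f3 f4 f5 f6].
  by rewrite /= !(f0, f1, f2, f3, f4, f5, f6).
split=> //; split=> // A [/contiguous_convex_mask convA /contiguous_convex_mask].
(* As [pi] is an involution, [o] lies in the image of [A] exactly when [pi o] lies in [A]; [.-1]
   undoes the shift of one-line notation. *)
have -> : [seq o \in pi @: A | o <- enum 'I_7] =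
    [seq nth false [seq o \in A | o <- enum 'I_7] v.-1 | v <- one_line pi].
  rewrite /one_line /image_mem -map_comp; apply: eq_map => o /=.
  rewrite (nth_map o) ?size_enum_ord // nth_ord_enum.
  have {1}-> : o = pi (pi o) by rewrite -{1}pi_inv permK.
  by rewrite (mem_imset _ _ (@perm_inj _ pi)).
rewrite pi_line card_count_enum; move: convA.
have: size [seq o \in A | o <- enum 'I_7] = 7 by rewrite size_map size_enum_ord.
case: [seq _ | o <- _] => [|b0 [|b1 [|b2 [|b3 [|b4 [|b5 [|b6 []]]]]]]] //= _.
by case: b0; case: b1; case: b2; case: b3; case: b4; case: b5; case: b6 => //= _ _;
  by [constructor 1 | constructor 2 | constructor 3].
Qed.

Lemma perm5274163_avoids2341 n (pi : 'S_n) :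
  one_line pi = [:: 5; 2; 7; 4; 1; 6; 3] -> avoids pi [:: 2; 3; 4; 1].
Proof.
move=> pi_line /contains2341P[i [j [k [l /and5P[ij kl]]]]].
pose g := nth 0 [:: 5; 2; 7; 4; 1; 6; 3].
have n7 : n = 7.
  by have := congr1 size pi_line; rewrite one_lineE size_map size_iota.
have fE u : u < n -> g u = (perm_fun pi u).+1.
  by move=> u_n; rewrite /g -pi_line one_lineE (nth_map 0) ?size_iota // nth_iota.
have no : all (fun i => all (fun j => all (fun k => all (fun l =>
    ~~ [&& i < j < k, k < l, g l < g i, g i < g j & g j < g k])
    (iota 0 7)) (iota 0 7)) (iota 0 7)) (iota 0 7) by [].
have in7 u : u < n -> u \in iota 0 7 by rewrite n7 mem_iota.
have [i_n j_n k_n l_n] : [/\ i < n, j < n, k < n & l < n] by split; lia.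
move: no => /allP/(_ i (in7 i i_n))/allP/(_ j (in7 j j_n)).
move=> /allP/(_ k (in7 k k_n))/allP/(_ l (in7 l l_n)).
rewrite !fE //; lia.
Qed.

Theorem theorem6p1 (n : nat) (pi : 'S_n) :
  (simple_perm pi /\ involution pi /\ avoids pi [:: 2; 3; 4; 1]) <->
  (one_line pi = [:: 5; 2; 7; 4; 1; 6; 3] \/
   (simple_perm pi /\ involution pi /\ avoids pi [:: 1; 2; 3])).
Proof.
split=> [[pi_simple [pi_inv pi_av]]|[pi_line|[? [? /avoids123_2341 ?]]]] //.
  (* Bounding the indices makes the existence of a 123 boolean, hence decidable. *)
  pose P i := [exists j : 'I_n, exists k : 'I_n, increasing3 n (perm_fun pi) i j k].
  have [/existsP[i] /existsP[j] /existsP[k inc]|/existsPn no] :=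
    boolP [exists i : 'I_n, P i].
    left; have Hf := simple_involution_perm_fun pi_simple pi_inv pi_av.
    have [x [b [z [inc_xbz min_x max_z]]]] := exists_extremal_increasing3 inc.
    have := leftmost_rightmost_eq5274163 Hf inc_xbz min_x max_z.
    by rewrite one_lineE (map_comp succn) => ->.
  right; split=> //; split=> // /contains123P[i [j [k inc]]].
  have [i_n j_n k_n] : [/\ i < n, j < n & k < n] by case/and5P: (inc); split; lia.
  case/negP: (no (Ordinal i_n)); apply/existsP; exists (Ordinal j_n).
  by apply/existsP; exists (Ordinal k_n).
have [pi_simple pi_inv] := perm5274163_simple_involution pi_line.
by split=> //; split=> //; apply: perm5274163_avoids2341.
Qed.
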